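(* Let $n,\ell\ge1$ be integers, let $J_1,\dots,J_\ell$ be nonempty subsets of $\{1,\dots,n\}$, let $C,C'>0$ be constants, and let $J_j$ be a largest of the sets $J_1,\dots,J_\ell$. For $\varepsilon>0$ set $$B_{\mathrm{dense}}(\varepsilon)=\binom{n+C\varepsilon^{-1/2}}{C\varepsilon^{-1/2}},\qquad B_{\mathrm{sparseSchm}}(\varepsilon)=\ell\binom{|J_j|\big(1+C'\varepsilon^{-\frac{|J_j|+3}{2}}\big)}{|J_j|\,C'\varepsilon^{-\frac{|J_j|+3}{2}}}.$$ If $n>|J_i|(|J_i|+3)$ for all $i=1,\dots,\ell$, then $$\lim_{\varepsilon\searrow0}\frac{B_{\mathrm{sparseSchm}}(\varepsilon)}{B_{\mathrm{dense}}(\varepsilon)}=0.$$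
   Context: Binomial coefficients with real entries are understood via the Gamma function: $\binom{a+t}{t}=\frac{\Gamma(a+t+1)}{\Gamma(a+1)\Gamma(t+1)}$ for real $a,t\geq 0$. *)

(* Defs.v *)
From HB Require Import structures.
From mathcomp Require Import all_boot all_order all_algebra.
From mathcomp Require Import all_classical all_reals all_analysis.
Set Implicit Arguments.
Unset Strict Implicit.
Unset Printing Implicit Defensive.
Import Order.TTheory GRing.Theory Num.Theory.
Import numFieldNormedType.Exports.
Local Open Scope classical_set_scope.
Local Open Scope ring_scope.

(* Euler's integral, meaningful for [0 < x]; [Rintegral] returns a junk real
   when the integral diverges. *)
Definition Gamma {R : realType} (x : R) : R :=
  Rintegral lebesgue_measure `]0, +oo[ (fun t : R => t `^ (x - 1) * expR (- t)).

(* [rbinom x t] is "x choose t"; the formula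
   Gamma (a + t + 1) / (Gamma (a + 1) * Gamma (t + 1)) for "a + t choose t"
   is the case [x = a + t], with [0 <= a] and [0 <= t]. *)
Definition rbinom {R : realType} (x t : R) : R :=
  Gamma (x + 1) / (Gamma (x - t + 1) * Gamma (t + 1)).

Definition B_dense {R : realType} (n : nat) (C e : R) : R :=
  rbinom (n%:R + C * e `^ (- (1 / 2))) (C * e `^ (- (1 / 2))).

Definition B_sparseSchm {R : realType} (n l : nat) (J : 'I_l -> {set 'I_n})
    (j : 'I_l) (C' e : R) : R :=
  let k : R := #|J j|%:R in
  l%:R * rbinom (k * (1 + C' * e `^ (- ((k + 3) / 2))))
                (k * C' * e `^ (- ((k + 3) / 2))).

(* Main.v *)
Require Import Defs.
From HB Require Import structures.
From mathcomp Require Import all_boot all_order all_algebra.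
From mathcomp Require Import all_classical all_reals all_analysis.
From mathcomp Require Import measurable_realfun ring.
Import Order.TTheory GRing.Theory Num.Theory.
Import numFieldNormedType.Exports.
Local Open Scope classical_set_scope.
Local Open Scope ring_scope.

(** For an integer [m], the recurrence of [Gamma] turns "m + t choose t" into a
    polynomial of degree [m] in [t]. With [k = #|J j|], the numerator is thus of
    order [(e^(-(k+3)/2))^k] and the denominator of order [(e^(-1/2))^n], so the
    quotient is [O(e^((n - k(k+3))/2))], whose exponent is positive. *)

(** * Exponential decay against powers, and limits at 0 and infinity *)

Lemma powR_le_expR_half (R : realType) (p x : R) : 0 < p -> 0 <= x ->
  x `^ p <= (2 * p) `^ p * expR (x / 2).
Proof.
move=> p0 x0; have p20 : 0 < 2 * p by rewrite mulr_gt0.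
have -> : x / 2 = x / (2 * p) * p by field; rewrite gt_eqF.
rewrite expRM -powRM ?expR_ge0 ?(ltW p20)//.
apply: ge0_ler_powR; rewrite ?nnegrE ?(ltW p0)//.
  by rewrite mulr_ge0 ?expR_ge0 ?(ltW p20).
(* After taking [p]-th roots, this is [1 + y <= expR y] at [y = x / (2 * p)]. *)
rewrite mulrC -ler_pdivrMr//; apply: le_trans (expR_ge1Dx _).
by rewrite lerDr.
Qed.

Lemma expR_half_cvgy (R : realType) (c : R) :
  c * expR (- (x / 2)) @[x --> +oo] --> (0 : R).
Proof.
rewrite -(mulr0 c); apply: cvgMl_tmp.
have h : x / 2 @[x --> +oo] --> (+oo : set_system R).
  by apply: gt0_cvgMly => //; exact: cvg_id.
exact: (@cvg_comp _ _ _ (fun x : R => x / 2) (fun x => expR (- x)) _ _ _ h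
  (@cvgr_expR R)).
Qed.

(** Half of the exponential absorbs the power; the other half still decays and has an explicit
    primitive, which makes it a convenient dominating function. *)
Lemma powR_expRN_le (R : realType) (p x : R) : 0 < p -> 0 <= x ->
  x `^ p * expR (- x) <= (2 * p) `^ p * expR (- (x / 2)).
Proof.
move=> p0 x0; have -> : - (x / 2) = x / 2 - x by field.
by rewrite expRD mulrA ler_pM2r ?expR_gt0// powR_le_expR_half.
Qed.

Lemma powR_expRN_cvgy (R : realType) (p : R) : 0 < p ->
  x `^ p * expR (- x) @[x --> +oo] --> (0 : R).
Proof.
move=> p0; apply: (@squeeze_cvgr _ _ _ _ (cst 0)
    (fun x => (2 * p) `^ p * expR (- (x / 2)))).
- have := nbhs_pinfty_ge (num_real (0 : R)); apply: filterS => x x0.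
  by rewrite /= mulr_ge0 ?powR_ge0 ?expR_ge0//= powR_expRN_le.
- exact: cvg_cst.
- exact: expR_half_cvgy.
Qed.

(** The limit is left as the unsimplified value at 0, so that it reads directly as right-continuity
    there. *)
Lemma powR_expRN_cvg0 (R : realType) (p : R) : 0 < p ->
  x `^ p * expR (- x) @[x --> 0^'+] --> 0 `^ p * expR (- 0).
Proof.
move=> p0; apply: cvgM; first by rewrite powR0 ?gt_eqF//; exact: powR_cvg0.
apply: cvg_at_right_filter; apply: (continuous_comp _ (@continuous_expR R _)).
exact: opp_continuous.
Qed.

(** * Derivatives, continuity and measurability of the integrands *)

Lemma is_derive_expRN (R : realType) (x : R) :
  is_derive x 1 (fun y => expR (- y)) (- expR (- x)).
Proof.
have := is_derive1_comp (is_derive_expR (- x)) (is_deriveNid x 1).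
by rewrite mulrN1.
Qed.

Lemma is_derive_powR_expRN (R : realType) (p x : R) : 0 < x ->
  is_derive x 1 (fun y => y `^ p * expR (- y))
    (p * (x `^ (p - 1) * expR (- x)) - x `^ p * expR (- x)).
Proof.
move=> x0.
apply: (is_derive_eq
  (is_deriveM (is_derive1_powR p x0) (is_derive_expRN R x))).
rewrite /= /GRing.scale/=; ring.
Qed.

Lemma is_derive_expRN_half (R : realType) (c x : R) :
  is_derive x 1 (fun y => c * expR (- (y / 2))) (- (c / 2) * expR (- (x / 2))).
Proof.
have h : is_derive x 1 ( *%R 2^-1) (2^-1 : R).
  apply: (is_derive_eq (is_deriveZ (2^-1) (is_derive_id x (1 : R)))).
  by rewrite /GRing.scale/= mulr1.
have e : (fun y : R => c * expR (- (y / 2))) =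
    c \*: ((fun y => expR (- y)) \o ( *%R 2^-1)).
  by apply/funext => y /=; rewrite [y / 2]mulrC.
rewrite e.
apply: (is_derive_eq
  (is_deriveZ c (is_derive1_comp (is_derive_expRN R _) h))).
rewrite /GRing.scale/= [2^-1 * x]mulrC; by field.
Qed.

Lemma powR_expRN_continuous (R : realType) (p : R) : 0 < p ->
  {within `[0, +oo[, continuous (fun x => x `^ p * expR (- x))}.
Proof.
move=> p0; apply/continuous_within_itvcyP; split; last exact: powR_expRN_cvg0.
move=> x; rewrite in_itv/= andbT => x0.
apply/differentiable_continuous/derivable1_diffP.
by have [] := is_derive_powR_expRN _ p x x0.
Qed.

Lemma expRN_half_continuous (R : realType) (c : R) :
  continuous (fun x : R => c * expR (- (x / 2))).
Proof.
move=> x; apply/differentiable_continuous/derivable1_diffP.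
by have [] := is_derive_expRN_half R c x.
Qed.

Lemma measurable_powR_expRN (R : realType) (p : R) (D : set R) :
  measurable_fun D (fun x => x `^ p * expR (- x)).
Proof.
apply: measurable_funTS; apply: measurable_funM.
  exact: (@measurableT_comp _ _ _ _ _ _ (@powR R ^~ p)).
by apply: measurableT_comp => //; exact: measurableT_comp.
Qed.

Lemma measurable_expRN_half (R : realType) (c : R) (D : set R) :
  measurable_fun D (fun x => c * expR (- (x / 2))).
Proof.
apply: measurable_funTS; apply: continuous_measurable_fun.
exact: expRN_half_continuous.
Qed.

(** * The functional equation of Gamma *)

Lemma GammaE (R : realType) (a : R) :
  Gamma (a + 1) = fine (\int[lebesgue_measure]_(x in `[0%R, +oo[)
    (x `^ a * expR (- x))%:E)%E.
Proof.
(* The endpoint 0 is a null set; closing the interval gives the domain on which the fundamental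
   theorem is applied. *)
rewrite /Gamma /Rintegral addrK integral_itv_obnd_cbnd//.
by apply/measurable_EFinP; exact: measurable_powR_expRN.
Qed.

Lemma Gamma_rec (R : realType) (a : R) : 1 < a -> Gamma (a + 1) = a * Gamma a.
Proof.
(* With exponent [a - 1 > 0], the integrand of [Gamma a] is continuous up to 0 and dominated by a
   multiple of [expR (- (x / 2))]. *)
move=> a1; have p0 : 0 < a - 1 by rewrite subr_gt0.
have a0 : 0 < a by exact: lt_trans a1.
have -> : Gamma a = Gamma (a - 1 + 1) by rewrite subrK.
rewrite !GammaE.
(* The difference of the two integrands is the derivative of
   [- x `^ a * expR (- x)], which changes sign. Adding the integrable [h], large
   enough to make it nonnegative, gives access to the fundamental theorem for
   nonnegative functions; the integrals of [h] and [q] coincide and cancel. *)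
pose K := a * (2 * (a - 1)) `^ (a - 1).
pose h (x : R) := K * expR (- (x / 2)).
pose q (x : R) :=
  h x - (a * (x `^ (a - 1) * expR (- x)) - x `^ a * expR (- x)).
have K0 : 0 <= K by rewrite mulr_ge0 ?powR_ge0 ?(ltW a0).
have h0 x : 0 <= h x by rewrite mulr_ge0 ?expR_ge0.
have f0 b x : 0 <= x `^ b * expR (- x) :> R.
  by rewrite mulr_ge0 ?powR_ge0 ?expR_ge0.
(* Only the term with exponent [a - 1] enters [q] negatively; [K] is [a] times the constant of
   [powR_expRN_le] at [p = a - 1]. *)
have q0 x : 0 <= x -> 0 <= q x.
  move=> x0; rewrite /q opprB addrCA addr_ge0// subr_ge0 /h /K -mulrA.
  by rewrite ler_pM2l// powR_expRN_le.
have h_continuous : {within `[0, +oo[, continuous h}.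
  by apply: continuous_subspaceT; exact: expRN_half_continuous.
have q_continuous : {within `[0, +oo[, continuous q}.
  move=> x; apply: cvgB; first exact: h_continuous.
  apply: cvgB; last exact: powR_expRN_continuous.
  by apply: cvgMl_tmp; exact: powR_expRN_continuous.
pose H (x : R) := - (2 * K) * expR (- (x / 2)).
have Hcont : continuous H by exact: expRN_half_continuous.
have dH (x : R) : is_derive x 1 H (h x).
  by apply: (is_derive_eq (is_derive_expRN_half _ _ x)); rewrite /h; field.
have int_h : (\int[lebesgue_measure]_(x in `[0%R, +oo[) (h x)%:E =
    0%:E - (H 0)%:E)%E.
  apply: ge0_continuous_FTC2y => //.
  - exact: expR_half_cvgy.
  - by apply: cvg_at_right_filter; exact: Hcont.
  - by move=> x _; rewrite derive1E derive_val.
pose F (x : R) := H x - x `^ a * expR (- x).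
have dF (x : R) : 0 < x -> is_derive x 1 F (q x).
  move=> x0; exact: (is_deriveB (dH x) (is_derive_powR_expRN _ a x x0)).
(* The primitives [F] and [H] agree at 0 and both vanish at infinity, so [q] and [h] have the same
   integral. *)
have F0 : F 0 = H 0 by rewrite /F powR0 ?gt_eqF// mul0r subr0.
have int_q : (\int[lebesgue_measure]_(x in `[0%R, +oo[) (q x)%:E =
    0%:E - (H 0)%:E)%E.
  rewrite -F0; apply: (@ge0_continuous_FTC2y R q F 0 0).
  - exact: q0.
  - exact: q_continuous.
  - rewrite -[0]subr0; apply: cvgB; first exact: expR_half_cvgy.
    exact: powR_expRN_cvgy.
  - by move=> x /dF [].
  - apply: cvgB; last exact: powR_expRN_cvg0.
    by apply: cvg_at_right_filter; exact: Hcont.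
  - move=> x; rewrite in_itv/= andbT => /dF dFx.
    by rewrite derive1E derive_val.
(* Moving the negative terms across leaves nonnegative summands on both sides, so the integrals
   split without any integrability argument. *)
have : (\int[lebesgue_measure]_(x in `[0%R, +oo[)
      ((x `^ a * expR (- x))%:E + (h x)%:E) =
    \int[lebesgue_measure]_(x in `[0%R, +oo[)
      (a%:E * (x `^ (a - 1) * expR (- x))%:E + (q x)%:E))%E.
  apply: eq_integral => x _; rewrite -EFinM -!EFinD; congr EFin.
  rewrite /q; ring.
have mf b : measurable_fun (`[0, +oo[ : set R)
    (fun x => (x `^ b * expR (- x))%:E).
  by apply/measurable_EFinP; exact: measurable_powR_expRN.
have mh : measurable_fun (`[0, +oo[ : set R) (fun x => (h x)%:E).
  by apply/measurable_EFinP; exact: measurable_expRN_half.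
have mq : measurable_fun (`[0, +oo[ : set R) (fun x => (q x)%:E).
  apply/measurable_EFinP; apply: measurable_funB.
    exact: measurable_expRN_half.
  apply: measurable_funB; last exact: measurable_powR_expRN.
  by apply: measurable_funM => //; exact: measurable_powR_expRN.
rewrite ge0_integralD//; last 3 first.
- by move=> x _; rewrite lee_fin.
- exact: mf.
- by move=> x _; rewrite lee_fin.
rewrite ge0_integralD//; last 3 first.
- by move=> x _; rewrite -EFinM lee_fin mulr_ge0// ltW.
- by apply: measurable_funeM; exact: mf.
- by move=> x /=; rewrite in_itv/= andbT lee_fin; exact: q0.
(* The common integral of [h] and [q] is finite, hence cancellable in the extended reals. *)
rewrite int_h int_q -EFinB => /(congr1 (fun y => y - (0 - H 0)%:E)%E).
rewrite !addeK// => ->.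
rewrite ge0_integralZl_EFin ?(ltW a0)//; last 2 first.
- by move=> x _; rewrite lee_fin.
- exact: mf.
set I := integral _ _ _.
(* [fine] sends an infinite integral to 0, so no convergence is needed. *)
case: I => [r| |] //=.
- by rewrite gt0_muley ?lte_fin//= mulr0.
- by rewrite gt0_muleNy ?lte_fin//= mulr0.
Qed.

(** * Binomials as rising products *)

Lemma Gamma_rising (R : realType) (m : nat) (t : R) : 0 < t ->
  Gamma (m%:R + t + 1) = \prod_(i < m) (t + i.+1%:R) * Gamma (t + 1).
Proof.
move=> t0; elim: m => [|m IHm]; first by rewrite big_ord0 add0r mul1r.
have -> : m.+1%:R + t = m%:R + t + 1 by rewrite -natr1; ring.
rewrite (Gamma_rec _ (m%:R + t + 1)); last by rewrite ltrDr ltr_wpDl.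
rewrite IHm big_ord_recr /= mulrA; congr (_ * _); rewrite mulrC -natr1; ring.
Qed.

(** The last factor stays uncancelled: it is 1 or, by the convention for division by zero, 0. *)
Lemma rbinom_natD (R : realType) (m : nat) (t : R) : 0 < t ->
  rbinom (m%:R + t) t = \prod_(i < m) (t + i.+1%:R) / Gamma (m%:R + 1) *
    (Gamma (t + 1) / Gamma (t + 1)).
Proof. by move=> t0; rewrite /rbinom Gamma_rising// addrK invfM; ring. Qed.

Lemma rising_prod_ge (R : realType) (m : nat) (t : R) : 0 < t ->
  t ^+ m <= \prod_(i < m) (t + i.+1%:R).
Proof.
move=> t0; rewrite -[X in _ ^+ X]card_ord -prodr_const.
by apply: ler_prod => i _; rewrite (ltW t0) lerDl ler0n.
Qed.

Lemma rising_prod_le (R : realType) (m : nat) (t : R) : 0 < t ->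
  \prod_(i < m) (t + i.+1%:R) <= (t + m%:R) ^+ m.
Proof.
move=> t0; rewrite -[X in _ ^+ X]card_ord -prodr_const.
by apply: ler_prod => i _; rewrite addr_ge0 ?(ltW t0)//= lerD2l ler_nat.
Qed.

(* A vanishing [Gamma (t + 1)] would only make the quotient 0, since x / 0 = 0;
   hence the positivity of [Gamma] is never needed. *)
Lemma norm_rbinom_div_le (R : realType) (k n : nat) (s t : R) :
  0 < s -> 0 < t ->
  `|rbinom (k%:R + s) s / rbinom (n%:R + t) t| <=
    `|Gamma (n%:R + 1) / Gamma (k%:R + 1)| * ((s + k%:R) ^+ k / t ^+ n).
Proof.
move=> s0 t0; rewrite !rbinom_natD//.
set P := \prod_(i < k) _; set Q := \prod_(i < n) _.
have P0 : 0 <= P by apply: prodr_ge0 => i _; rewrite addr_ge0 ?(ltW s0).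
have tn0 : 0 < t ^+ n by rewrite exprn_gt0.
have PQ : P / Q <= (s + k%:R) ^+ k / t ^+ n.
  have Qt : t ^+ n <= Q by exact: rising_prod_ge.
  rewrite ler_pM ?invr_ge0 ?rising_prod_le//.
    by rewrite (le_trans (ltW tn0)).
  by rewrite lef_pV2// posrE (lt_le_trans tn0).
have Q0 : 0 <= Q by apply: prodr_ge0 => i _; rewrite addr_ge0 ?(ltW t0).
have div_le1 (x : R) : `|x / x| <= 1.
  have [->|x0] := eqVneq x 0; first by rewrite mul0r normr0 ler01.
  by rewrite divff// normr1.
have div_inv_le1 (x : R) : `|(x / x)^-1| <= 1 by rewrite invf_div.
set u := Gamma (s + 1) / _; set v := Gamma (t + 1) / _.
have -> : P / Gamma (k%:R + 1) * u / (Q / Gamma (n%:R + 1) * v) =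
    Gamma (n%:R + 1) / Gamma (k%:R + 1) * (P / Q) * (u * v^-1).
  by rewrite !invfM invrK; ring.
rewrite normrM normrM.
rewrite -[leRHS]mulr1 ler_pM ?mulr_ge0//.
  by rewrite ler_wpM2l// ger0_norm// divr_ge0.
by rewrite normrM mulr_ile1// ?div_le1// div_inv_le1.
Qed.

(** * The limit of the quotient *)

Theorem proposition3 (R : realType) (n l : nat) (hn : (1 <= n)%N) (hl : (1 <= l)%N)
    (J : 'I_l -> {set 'I_n}) (hJ : forall i : 'I_l, J i != finset.set0)
    (C C' : R) (hC : 0 < C) (hC' : 0 < C')
    (j : 'I_l) (hj : forall i : 'I_l, (#|J i| <= #|J j|)%N)
    (hJn : forall i : 'I_l, (#|J i| * (#|J i| + 3) < n)%N) :
  (B_sparseSchm J j C' e / B_dense n C e) @[e --> 0^'+] --> (0 : R).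
Proof.
have k0 : (0 < #|J j|)%N by rewrite card_gt0.
have := hJn j; rewrite /B_sparseSchm /B_dense; move: #|J j| k0 => k k0 hkn.
have kR0 : 0 < k%:R :> R by rewrite ltr0n.
pose A := (l%:R : R) * (`|Gamma (n%:R + 1 : R) / Gamma (k%:R + 1)| *
  ((k%:R * (C' + 1)) ^+ k / C ^+ n)).
(* Half the gap in [hJn j]: the power of [e] left after comparing both orders of growth. *)
pose d : R := (n%:R - k%:R * (k%:R + 3)) / 2.
have d0 : 0 < d.
  by rewrite divr_gt0// subr_gt0 -natrD -natrM ltr_nat.
apply: norm_cvg0.
apply: (@squeeze_cvgr _ _ _ _ (cst 0) (fun e => A * e `^ d)).
- near=> e.
  have e0 : 0 < e by near: e; exact: nbhs_right_gt.
  have e1 : e <= 1 by near: e; exact: nbhs_right_le.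
  rewrite normr_ge0 /=.
  set s := e `^ (- ((k%:R + 3) / 2)).
  set r := e `^ (- (1 / 2)).
  have s0 : 0 < s by rewrite powR_gt0.
  have r0 : 0 < r by rewrite powR_gt0.
  (* For [e <= 1] this lets the additive [k] be absorbed: [k * C' * s + k <= k * (C' + 1) * s], the
     source of [C' + 1] in [A]. *)
  have s1 : 1 <= s.
    rewrite -(powRr0 e); apply: ger_powR; first by rewrite e0 e1.
    by rewrite oppr_le0 divr_ge0// addr_ge0.
  have -> : k%:R * (1 + C' * s) = k%:R + k%:R * C' * s by ring.
  rewrite -[_ * _ / _]mulrA normrM [`|l%:R|]ger0_norm//.
  rewrite /A -[leRHS]mulrA ler_wpM2l//.
  apply: le_trans (norm_rbinom_div_le _ _ _ _ _ _ _) _.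
  + by rewrite !mulr_gt0.
  + by rewrite mulr_gt0.
  rewrite -[leRHS]mulrA ler_wpM2l//.
  (* The exponents add up to [- k * (k + 3) / 2 + n / 2]. *)
  have sr : s ^+ k / r ^+ n = e `^ d.
    rewrite -!powR_mulrn ?(ltW s0) ?(ltW r0)// -!powRrM -powRN -powRD.
      by congr (_ `^ _); rewrite /d; field.
    by rewrite (gt_eqF e0) implybT.
  rewrite -sr exprMn invfM mulrACA -exprMn ler_wpM2r//.
    by rewrite mulr_ge0 ?invr_ge0 ?exprn_ge0 ?(ltW r0) ?(ltW hC).
  apply: lerXn2r; rewrite ?nnegrE.
  + by rewrite addr_ge0 ?mulr_ge0 ?(ltW hC') ?(ltW s0).
  + by rewrite !mulr_ge0 ?addr_ge0 ?(ltW hC') ?(ltW s0).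
  by rewrite mulrDr mulr1 mulrDl lerD2l ler_peMr.
- exact: cvg_cst.
- rewrite -[X in _ --> X](mulr0 A); apply: cvgMl_tmp; exact: powR_cvg0.
Unshelve. all: by end_near. Qed.
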